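(* Let $d\in\mathbb{N}$, $u\in\mathbb{C}\setminus\{0\}$, let $\mathrm{x}_1,\dots,\mathrm{x}_{d-1}\in\mathbb{C}\setminus\{0\}$ and set $\mathrm{x}_0:=1$. Let $\theta:\mathbb{C}[z,x_1,\dots,x_{d-1}]\to\mathbb{C}[z]$ be the ring homomorphism (identity on $\mathbb{C}$) with $\theta(z)=z$ and $\theta(x_m)=\mathrm{x}_m$ for $1\le m\le d-1$. Let $$\varphi:\bigcup_{n\ge 0}\mathrm{Y}_{d,n}(u)\longrightarrow\bigcup_{n\ge 0}\mathrm{Y}_{d,n}(u)$$ be the linear map defined inductively on $\mathrm{Y}_{d,n}(u)$, for all $n\in\mathbb{N}$, by the rules $$\varphi(1)=1,\qquad \varphi(w_ng_ng_{n-1}\cdots g_it_i^k)=g_n\,\varphi(w_ng_{n-1}\cdots g_it_i^k),\qquad \varphi(w_nt_{n+1}^k)=\mathrm{x}_k\,\varphi(w_n),$$ where $w_n\in\mathrm{Y}_{d,n}(u)$, $1\le i\le n$ and $k\in\mathbb{Z}/d\mathbb{Z}$. Then $$\mathrm{tr}\circ\varphi=\theta\circ\mathrm{tr}.$$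
   Context: Yokonuma-Hecke algebra $\mathrm{Y}_{d,n}(u)$: the associative $\mathbb{C}$-algebra generated by $g_1,\dots,g_{n-1},t_1,\dots,t_n$ with relations $g_ig_j=g_jg_i$ for $|i-j|>1$; $g_ig_jg_i=g_jg_ig_j$ for $|i-j|=1$; $t_it_j=t_jt_i$; $t_jg_i=g_it_{s_i(j)}$ where $s_i=(i,i+1)$; $t_j^d=1$; and $g_i^2=1+(u-1)e_i+(u-1)e_ig_i$, where $e_i:=\frac1d\sum_{s=0}^{d-1}t_i^st_{i+1}^{-s}$. We use the natural inclusions $\mathrm{Y}_{d,n}(u)\subset\mathrm{Y}_{d,n+1}(u)$, $\mathrm Y_{d,0}(u)=\mathbb C$. Known inductive basis: every element of $\mathrm{Y}_{d,n+1}(u)$ is a unique linear combination of words $w_ng_ng_{n-1}\cdots g_it_i^k$ ($1\le i\le n$) and $w_nt_{n+1}^k$, with $k\in\mathbb{Z}/d\mathbb{Z}$ and $w_n$ in the (inductively obtained) basis of $\mathrm{Y}_{d,n}(u)$. For $i=n$, the word $w_ng_n\cdots g_it_i^k$ is $w_ng_nt_n^k$ and $w_ng_{n-1}\cdots g_it_i^k$ means $w_nt_n^k$. The Juyumaya trace is the unique linear map $\mathrm{tr}:\bigcup_n\mathrm{Y}_{d,n}(u)\to\mathbb{C}[z,x_1,\dots,x_{d-1}]$ ($z,x_1,\dots,x_{d-1}$ indeterminates) with $\mathrm{tr}(ab)=\mathrm{tr}(ba)$, $\mathrm{tr}(1)=1$, $\mathrm{tr}(ag_n)=z\,\mathrm{tr}(a)$,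 $\mathrm{tr}(at_{n+1}^m)=x_m\mathrm{tr}(a)$ ($1\le m\le d-1$) for $a,b\in\mathrm{Y}_{d,n}(u)$ and all $n$. The ring $\mathbb{C}[z]$ is regarded as a subring of $\mathbb{C}[z,x_1,\dots,x_{d-1}]$. *)

(* Defs.v *)
From HB Require Import structures.
From mathcomp Require Import all_boot all_order perm all_algebra.
From mathcomp Require Import boolp reals complex mpoly monalg.

Set Implicit Arguments.
Unset Strict Implicit.
Unset Printing Implicit Defensive.

Import GRing.Theory.
Local Open Scope quotient_scope.
Local Open Scope ring_scope.

Section FreeAlgebra.
Variables (k : comNzRingType) (I : choiceType).

Local Notation M := {malg k[{fmonom I}]}.

(* The operations and generators below are locked so that unification does not
   unfold them down to finitely supported functions or class representatives. *)
Definition free_alg := M.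
HB.instance Definition _ := GRing.Lmodule.on free_alg.

Definition free_mul : free_alg -> free_alg -> free_alg :=
  locked (fun x y : M => x * y).

Definition free_gen : I -> free_alg := locked (fun i => << fmu i >> : M).

Lemma free_mulE x y : free_mul x y = (x : M) * (y : M).
Proof. by rewrite /free_mul -lock. Qed.

Lemma free_genE i : free_gen i = << fmu i >> :> M.
Proof. by rewrite /free_gen -lock. Qed.

Lemma free_mulA : associative free_mul.
Proof. by move=> x y z; rewrite !free_mulE mulrA. Qed.

Lemma free_mul1 : left_id (1 : M) free_mul.
Proof. by move=> x; rewrite free_mulE mul1r. Qed.

Lemma free_mulr1 : right_id (1 : M) free_mul.
Proof. by move=> x; rewrite free_mulE mulr1. Qed.

Lemma free_mulDl : left_distributive free_mul +%R.
Proof. by move=> x y z; rewrite !free_mulE mulrDl. Qed.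

Lemma free_mulDr : right_distributive free_mul +%R.
Proof. by move=> x y z; rewrite !free_mulE mulrDr. Qed.

HB.instance Definition _ := GRing.Zmodule_isNzRing.Build free_alg
  free_mulA free_mul1 free_mulr1 free_mulDl free_mulDr (oner_neq0 M).

Lemma free_scalerAl (c : k) (x y : free_alg) :
  c *: free_mul x y = free_mul (c *: x) y.
Proof. by rewrite !free_mulE; exact: (@scalerAl k M). Qed.
HB.instance Definition _ :=
  GRing.Lmodule_isLalgebra.Build k free_alg free_scalerAl.

Lemma free_scalerAr (c : k) (x y : free_alg) :
  c *: free_mul x y = free_mul x (c *: y).
Proof.
have commC (z : M) : z * c%:MP = c *: z.
  rewrite malgM_def malgZ_def fgmulgU; apply: eq_bigr => m _.
  by rewrite mulm1 mulrC.
by rewrite !free_mulE -[LHS]commC -[in RHS]commC mulrA.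
Qed.
HB.instance Definition _ :=
  GRing.Lalgebra_isAlgebra.Build k free_alg free_scalerAr.

Section Evaluation.
Variables (B : algType k) (f : I -> B).

Definition free_eval_monom (m : {fmonom I}) : B := \prod_(i <- m) f i.

Lemma free_eval_monomP : mmorphism free_eval_monom.
Proof.
split=> [x y|]; rewrite /free_eval_monom; last by rewrite fm1 big_nil.
by rewrite fmM big_cat.
Qed.
HB.instance Definition _ :=
  isMultiplicative.Build {fmonom I} B free_eval_monom free_eval_monomP.

Definition free_eval (x : free_alg) : B :=
  monalg.mmap (in_alg B) free_eval_monom x.

Lemma free_eval_zmod : zmod_morphism free_eval.
Proof. exact: raddfB. Qed.
HB.instance Definition _ :=
  GRing.isZmodMorphism.Build free_alg B free_eval free_eval_zmod.

Lemma free_eval_monoid : monoid_morphism free_eval.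
Proof.
have [M1 M2] : multiplicative (free_eval : M -> B).
  apply: commr_mmap_is_multiplicative => g m m'.
  by rewrite /GRing.comm /= -scalerAl mul1r -scalerAr mulr1.
by split=> // x y; rewrite [x * y]free_mulE M1.
Qed.
HB.instance Definition _ :=
  GRing.isMonoidMorphism.Build free_alg B free_eval free_eval_monoid.

Lemma free_eval_scalable : scalable free_eval.
Proof. by move=> c x; rewrite /free_eval monalg.mmapZ /= mulr_algl. Qed.
HB.instance Definition _ :=
  GRing.isScalable.Build k free_alg B *:%R free_eval free_eval_scalable.

Lemma free_evalM x y : free_eval (x * y) = free_eval x * free_eval y.
Proof. exact: rmorphM. Qed.

Lemma free_evalX x s : free_eval (x ^+ s) = free_eval x ^+ s.
Proof. exact: rmorphXn. Qed.

Lemma free_eval1 : free_eval 1 = 1.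
Proof. exact: rmorph1. Qed.

Lemma free_evalD x y : free_eval (x + y) = free_eval x + free_eval y.
Proof. exact: raddfD. Qed.

Lemma free_evalZ c x : free_eval (c *: x) = c *: free_eval x.
Proof. exact: linearZ. Qed.

Lemma free_eval_sum (J : Type) (r : seq J) (P : pred J) (F : J -> free_alg) :
  free_eval (\sum_(j <- r | P j) F j) = \sum_(j <- r | P j) free_eval (F j).
Proof. exact: raddf_sum. Qed.

Lemma free_evalE i : free_eval (free_gen i) = f i.
Proof.
rewrite free_genE /free_eval monalg.mmapU /= scale1r mul1r.
by rewrite /free_eval_monom fmU big_seq1.
Qed.

End Evaluation.

Lemma free_ind (P : free_alg -> Prop) :
    (forall c x y, P x -> P y -> P (c *: x + y)) ->
    P 1 -> (forall i x, P x -> P (free_gen i * x)) ->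
  forall x, P x.
Proof.
move=> PD P1 Pg x.
have P0 : P 0 by have := PD (-1) 1 1 P1 P1; rewrite scaleN1r addNr.
rewrite (monalgE (x : {malg _[_]})); elim/big_rec: _ => // m y _ Py.
have -> : << mcoeff m x *g m >> = mcoeff m x *: (<< m >> : free_alg).
  by apply/malgP => w; rewrite mcoeffZ !mcoeffU mulrnAr mulr1.
apply: PD => //; case: m => s; elim: s => [|i s IHs].
  by rewrite -fmoneE.
have -> : FMonom (i :: s) = mmul (fmu i) (FMonom s) :> {fmonom I}.
  by apply/eqP; rewrite fmP fmM fmU.
by have := Pg i _ IHs; rewrite [_ * _]free_mulE free_genE malgM_def fgmulUU mulr1.
Qed.

End FreeAlgebra.

Section PresentedAlgebra.
Variables (k : comNzRingType) (I : choiceType).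
Local Notation F := (free_alg k I).
Variable rel : F -> F -> Prop.

Inductive rel_ideal : F -> Prop :=
  | rel_ideal0 : rel_ideal 0
  | rel_idealD x y : rel_ideal x -> rel_ideal y -> rel_ideal (x + y)
  | rel_ideal_gen a l r b : rel l r -> rel_ideal (a * (l - r) * b).

Definition rel_ideal_pred : F -> bool := fun x => `[< rel_ideal x >].

Lemma rel_idealN x : rel_ideal x -> rel_ideal (- x).
Proof.
elim=> [|y z _ Hy _ Hz|a l r b lr]; first by rewrite oppr0; constructor.
  by rewrite opprD; constructor.
by rewrite -!mulNr; constructor.
Qed.

Lemma rel_idealMl a x : rel_ideal x -> rel_ideal (a * x).
Proof.
elim=> [|y z _ Hy _ Hz|c l r b lr]; first by rewrite mulr0; constructor.
  by rewrite mulrDr; constructor.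
by rewrite !mulrA; constructor.
Qed.

Lemma rel_idealMr a x : rel_ideal x -> rel_ideal (x * a).
Proof.
elim=> [|y z _ Hy _ Hz|c l r b lr]; first by rewrite mul0r; constructor.
  by rewrite mulrDl; constructor.
by rewrite -mulrA; constructor.
Qed.

Lemma rel_ideal_zmod_closed : zmod_closed rel_ideal_pred.
Proof.
split=> [|x y]; rewrite !unfold_in; first by apply/asboolP; constructor.
move=> /asboolP Hx /asboolP Hy; apply/asboolP.
by constructor=> //; apply: rel_idealN.
Qed.
HB.instance Definition _ :=
  GRing.isZmodClosed.Build F rel_ideal_pred rel_ideal_zmod_closed.

(* ring_quotient only puts a ring structure on quotients of commutative rings,
   so we reuse its quotient group and add the multiplication and the scaling. *)
Definition pres_alg :=
  Quotient.quot (GRing.ZmodClosed.clone F rel_ideal_pred _).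
HB.instance Definition _ := GRing.Zmodule.on pres_alg.
HB.instance Definition _ := EqQuotient.on pres_alg.

Definition pres_pi (x : F) : pres_alg := \pi x.

Lemma pres_piP x y : pres_pi x = pres_pi y <-> rel_ideal (x - y).
Proof.
split=> [|H]; first by move/eqP; rewrite -Quotient.idealrBE => /asboolP.
by apply/eqP; rewrite -Quotient.idealrBE; apply/asboolP.
Qed.

Lemma pres_reprK q : pres_pi (repr q) = q.
Proof. exact: reprK. Qed.

Lemma pres_repr_pi x : rel_ideal (repr (pres_pi x) - x).
Proof. by apply/pres_piP; exact: pres_reprK. Qed.

Lemma pres_pi_zmod : zmod_morphism pres_pi.
Proof. exact: (raddfB (\pi_pres_alg : {additive F -> pres_alg})). Qed.
HB.instance Definition _ :=
  GRing.isZmodMorphism.Build F pres_alg pres_pi pres_pi_zmod.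

Definition pres_mul : pres_alg -> pres_alg -> pres_alg :=
  locked (fun p q => pres_pi (repr p * repr q)).

Lemma pres_piM x y : pres_mul (pres_pi x) (pres_pi y) = pres_pi (x * y).
Proof.
rewrite /pres_mul -lock; apply/pres_piP; set x' := repr _; set y' := repr _.
have -> : x' * y' - x * y = x' * (y' - y) + (x' - x) * y.
  by rewrite mulrBr mulrBl addrA addrNK.
by apply: rel_idealD; [apply: rel_idealMl|apply: rel_idealMr];
  exact: pres_repr_pi.
Qed.

Lemma pres_mulA : associative pres_mul.
Proof.
move=> p q r; rewrite -[p]pres_reprK -[q]pres_reprK -[r]pres_reprK.
by rewrite !pres_piM mulrA.
Qed.

Lemma pres_mul1 : left_id (pres_pi 1) pres_mul.
Proof. by move=> p; rewrite -[p]pres_reprK pres_piM mul1r. Qed.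

Lemma pres_mulr1 : right_id (pres_pi 1) pres_mul.
Proof. by move=> p; rewrite -[p]pres_reprK pres_piM mulr1. Qed.

Lemma pres_mulDl : left_distributive pres_mul +%R.
Proof.
move=> p q r; rewrite -[p]pres_reprK -[q]pres_reprK -[r]pres_reprK.
by rewrite -raddfD !pres_piM -raddfD mulrDl.
Qed.

Lemma pres_mulDr : right_distributive pres_mul +%R.
Proof.
move=> p q r; rewrite -[p]pres_reprK -[q]pres_reprK -[r]pres_reprK.
by rewrite -raddfD !pres_piM -raddfD mulrDr.
Qed.

HB.instance Definition _ := GRing.Zmodule_isPzRing.Build pres_alg
  pres_mulA pres_mul1 pres_mulr1 pres_mulDl pres_mulDr.

Lemma pres_pi_monoid : monoid_morphism pres_pi.
Proof. by split=> // x y; rewrite -pres_piM. Qed.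
HB.instance Definition _ :=
  GRing.isMonoidMorphism.Build F pres_alg pres_pi pres_pi_monoid.

Definition pres_scale : k -> pres_alg -> pres_alg :=
  locked (fun c p => pres_pi (c *: repr p)).

Lemma pres_piZ c x : pres_scale c (pres_pi x) = pres_pi (c *: x).
Proof.
rewrite /pres_scale -lock; apply/pres_piP.
rewrite -scalerBr -[_ - _]mul1r scalerAl.
by apply: rel_idealMl; exact: pres_repr_pi.
Qed.

Lemma pres_scaleA a b p : pres_scale a (pres_scale b p) = pres_scale (a * b) p.
Proof. by rewrite -[p]pres_reprK !pres_piZ scalerA. Qed.

Lemma pres_scale1 : left_id 1 pres_scale.
Proof. by move=> p; rewrite -[p]pres_reprK pres_piZ scale1r. Qed.

Lemma pres_scaleDr : right_distributive pres_scale +%R.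
Proof.
move=> c p q; rewrite -[p]pres_reprK -[q]pres_reprK.
by rewrite -raddfD !pres_piZ -raddfD scalerDr.
Qed.

Lemma pres_scaleDl p : {morph pres_scale^~ p : a b / a + b}.
Proof.
by move=> a b; rewrite -[p]pres_reprK !pres_piZ -raddfD scalerDl.
Qed.

HB.instance Definition _ := GRing.Zmodule_isLmodule.Build k pres_alg
  pres_scaleA pres_scale1 pres_scaleDr pres_scaleDl.

Lemma pres_pi_scalable : scalable pres_pi.
Proof. by move=> c x; rewrite -pres_piZ. Qed.
HB.instance Definition _ :=
  GRing.isScalable.Build k F pres_alg *:%R pres_pi pres_pi_scalable.

Lemma pres_scaleAl (c : k) (p q : pres_alg) : c *: (p * q) = c *: p * q.
Proof.
rewrite -[p]pres_reprK -[q]pres_reprK.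
by rewrite -rmorphM -!linearZ -rmorphM scalerAl.
Qed.

Lemma pres_scaleAr (c : k) (p q : pres_alg) : c *: (p * q) = p * (c *: q).
Proof.
rewrite -[p]pres_reprK -[q]pres_reprK.
by rewrite -rmorphM -!linearZ -rmorphM scalerAr.
Qed.

Definition pres_gen : I -> pres_alg :=
  locked (fun i => pres_pi (free_gen k i)).

Lemma pres_genE i : pres_gen i = pres_pi (free_gen k i).
Proof. by rewrite /pres_gen -lock. Qed.

Lemma pres_ind (P : pres_alg -> Prop) :
    (forall c x y, P x -> P y -> P (c *: x + y)) ->
    P 1 -> (forall i x, P x -> P (pres_gen i * x)) ->
  forall x, P x.
Proof.
move=> PD P1 Pg x; rewrite -[x]pres_reprK; move: (repr x).
apply: free_ind => [c y z Py Pz||i y Py]; first by rewrite linearP; apply: PD.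
  by rewrite rmorph1.
by rewrite rmorphM /= -pres_genE; apply: Pg.
Qed.

Section UniversalProperty.
Variables (B : algType k) (f : I -> B).
Hypothesis fP : forall l r, rel l r -> free_eval f l = free_eval f r.

Lemma free_eval_ideal x : rel_ideal x -> free_eval f x = 0.
Proof.
elim=> [|y z _ Hy _ Hz|a l r b /fP lr]; first by rewrite raddf0.
  by rewrite raddfD /= Hy Hz addr0.
by rewrite !rmorphM raddfB /= lr subrr mulr0 mul0r.
Qed.

Definition pres_eval (x : pres_alg) : B := free_eval f (repr x).

Lemma pres_eval_pi x : pres_eval (pres_pi x) = free_eval f x.
Proof.
apply/eqP; rewrite -subr_eq0 -(raddfB (free_eval f)) /=.
by rewrite free_eval_ideal //; exact: pres_repr_pi.
Qed.

Lemma pres_eval_gen i : pres_eval (pres_gen i) = f i.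
Proof. by rewrite pres_genE pres_eval_pi free_evalE. Qed.

Lemma pres_eval_zmod : zmod_morphism pres_eval.
Proof.
move=> x y; rewrite -[x]pres_reprK -[y]pres_reprK -raddfB.
by rewrite !pres_eval_pi raddfB.
Qed.

Lemma pres_eval_monoid : monoid_morphism pres_eval.
Proof.
split=> [|x y]; first by rewrite -(rmorph1 pres_pi) pres_eval_pi rmorph1.
rewrite -[x]pres_reprK -[y]pres_reprK -rmorphM.
by rewrite !pres_eval_pi rmorphM.
Qed.

Lemma pres_eval_scalable : scalable pres_eval.
Proof.
by move=> c x; rewrite -[x]pres_reprK -linearZ !pres_eval_pi linearZ.
Qed.

Lemma pres_alg_neq0 : (1 : pres_alg) != 0.
Proof.
apply/eqP => H; have : pres_eval 1 = pres_eval 0 by rewrite H.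
rewrite pres_eval_monoid.1 -[0](subrr 0) pres_eval_zmod subrr.
by move/eqP; rewrite oner_eq0.
Qed.

End UniversalProperty.

End PresentedAlgebra.

(* The union of a tower of algebras, as its direct limit; A n is identified
   with its image under dirlim_in n. *)
Section DirectLimit.
Variables (k : comNzRingType) (A : nat -> algType k).
Variable f : forall m n, (m <= n)%N -> {lrmorphism A m -> A n}.
Hypothesis f_comp : forall l m n (h : (l <= m)%N) (h' : (m <= n)%N)
  (h'' : (l <= n)%N) a, f h' (f h a) = f h'' a.

Local Notation total := {n : nat & A n}.

Definition dirlim_eq (x y : total) : Prop :=
  exists N (hx : (tag x <= N)%N) (hy : (tag y <= N)%N),
    f hx (tagged x) = f hy (tagged y).

Definition dirlim_eqb (x y : total) : bool := `[< dirlim_eq x y >].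

Lemma dirlim_eqb_equiv : equiv_class_of dirlim_eqb.
Proof.
split=> [x|x y|y x z].
- by apply/asboolP; exists (tag x), (leqnn _), (leqnn _).
- by apply/asboolP/asboolP => -[N [hx [hy H]]]; exists N, hy, hx.
move=> /asboolP [M [hx [hy H]]] /asboolP [N [hy' [hz H']]]; apply/asboolP.
have hM := leq_maxl M N; have hN := leq_maxr M N.
exists (maxn M N), (leq_trans hx hM), (leq_trans hz hN).
rewrite -(f_comp hx hM) H (f_comp _ _ (leq_trans hy hM)).
by rewrite -(f_comp hz hN) -H' (f_comp _ _ (leq_trans hy hM)).
Qed.

Canonical dirlim_equiv := EquivRelPack dirlim_eqb_equiv.
Canonical dirlim_encModRel := defaultEncModRel dirlim_eqb.

Definition dirlim := {eq_quot dirlim_eqb}.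
HB.instance Definition _ := Choice.on dirlim.
HB.instance Definition _ := EqQuotient.on dirlim.

Definition dirlim_in n (a : A n) : dirlim := \pi_dirlim (Tagged A a).

Lemma dirlim_inP m n (a : A m) (b : A n) :
  dirlim_in a = dirlim_in b <->
  exists N (hm : (m <= N)%N) (hn : (n <= N)%N), f hm a = f hn b.
Proof.
by split=> [/eqmodP/asboolP //|H]; apply/eqmodP/asboolP.
Qed.

Lemma dirlim_in_map m n (h : (m <= n)%N) (a : A m) :
  dirlim_in (f h a) = dirlim_in a.
Proof. by apply/dirlim_inP; exists n, (leqnn _), h; exact: f_comp. Qed.

Lemma dirlim_repr (x : dirlim) : x = dirlim_in (tagged (repr x)).
Proof. by rewrite /dirlim_in; case: (repr x) (reprK x) => n a /= ->. Qed.

Variant dirlim_spec : dirlim -> Prop :=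
  DirlimSpec n (a : A n) : dirlim_spec (dirlim_in a).

Lemma dirlimP x : dirlim_spec x.
Proof. by rewrite [x]dirlim_repr; constructor. Qed.

Variant dirlim_spec2 : dirlim -> dirlim -> Prop :=
  DirlimSpec2 n (a b : A n) : dirlim_spec2 (dirlim_in a) (dirlim_in b).

Lemma dirlim2P x y : dirlim_spec2 x y.
Proof.
case: (dirlimP x) => m a; case: (dirlimP y) => n b.
by rewrite -(dirlim_in_map (leq_maxl m n)) -(dirlim_in_map (leq_maxr m n)).
Qed.

Variant dirlim_spec3 : dirlim -> dirlim -> dirlim -> Prop :=
  DirlimSpec3 n (a b c : A n) :
    dirlim_spec3 (dirlim_in a) (dirlim_in b) (dirlim_in c).

Lemma dirlim3P x y z : dirlim_spec3 x y z.
Proof.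
case: (dirlim2P x y) => m a b; case: (dirlimP z) => n c.
rewrite -!(dirlim_in_map (leq_maxl m n)) -(dirlim_in_map (leq_maxr m n)).
by constructor.
Qed.

Definition dirlim_op1 (op : forall n, A n -> A n) : dirlim -> dirlim :=
  locked (fun x => dirlim_in (op _ (tagged (repr x)))).

Definition dirlim_op2 (op : forall n, A n -> A n -> A n) :
    dirlim -> dirlim -> dirlim :=
  locked (fun x y =>
    let hx := leq_maxl (tag (repr x)) (tag (repr y)) in
    let hy := leq_maxr (tag (repr x)) (tag (repr y)) in
    dirlim_in (op _ (f hx (tagged (repr x))) (f hy (tagged (repr y))))).

Lemma dirlim_op1E (op : forall n, A n -> A n) :
    (forall m n (h : (m <= n)%N), {morph f h : x / op m x >-> op n x}) ->
  forall n (a : A n), dirlim_op1 op (dirlim_in a) = dirlim_in (op n a).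
Proof.
move=> fop n a; have /dirlim_inP := dirlim_repr (dirlim_in a).
move=> [N [hn [hr H]]]; rewrite /dirlim_op1 -lock.
by rewrite -(dirlim_in_map hr) fop -H -fop dirlim_in_map.
Qed.

Lemma dirlim_op2E (op : forall n, A n -> A n -> A n) :
    (forall m n (h : (m <= n)%N), {morph f h : x y / op m x y >-> op n x y}) ->
  forall n (a b : A n),
    dirlim_op2 op (dirlim_in a) (dirlim_in b) = dirlim_in (op n a b).
Proof.
move=> fop n a b; rewrite /dirlim_op2 -lock /=.
have /dirlim_inP [M [ha [hra Ha]]] := dirlim_repr (dirlim_in a).
have /dirlim_inP [N [hb [hrb Hb]]] := dirlim_repr (dirlim_in b).
set rx := repr _ in hra Ha *; set ry := repr _ in hrb Hb *.
have hM := leq_maxl M N; have hN := leq_maxr M N.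
have hmax : (maxn (tag rx) (tag ry) <= maxn M N)%N.
  by rewrite geq_max (leq_trans hra hM) (leq_trans hrb hN).
rewrite -(dirlim_in_map hmax) fop.
rewrite (f_comp _ _ (leq_trans hra hM)) (f_comp _ _ (leq_trans hrb hN)).
rewrite -(f_comp hra hM) -Ha -(f_comp hrb hN) -Hb.
rewrite (f_comp _ _ (leq_trans ha hM)) (f_comp _ _ (leq_trans ha hM)).
by rewrite -fop dirlim_in_map.
Qed.

Definition dirlim_add := dirlim_op2 (fun n => +%R).
Definition dirlim_opp := dirlim_op1 (fun n => -%R).
Definition dirlim_mul := dirlim_op2 (fun n => *%R).
Definition dirlim_scale c := dirlim_op1 (fun n => *:%R c).

Lemma dirlim_addE n (a b : A n) :
  dirlim_add (dirlim_in a) (dirlim_in b) = dirlim_in (a + b).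
Proof. by apply: dirlim_op2E => ? ? ? ? ?; rewrite raddfD. Qed.

Lemma dirlim_oppE n (a : A n) : dirlim_opp (dirlim_in a) = dirlim_in (- a).
Proof. by apply: dirlim_op1E => ? ? ? ?; rewrite raddfN. Qed.

Lemma dirlim_mulE n (a b : A n) :
  dirlim_mul (dirlim_in a) (dirlim_in b) = dirlim_in (a * b).
Proof. by apply: dirlim_op2E => ? ? ? ? ?; rewrite rmorphM. Qed.

Lemma dirlim_scaleE c n (a : A n) :
  dirlim_scale c (dirlim_in a) = dirlim_in (c *: a).
Proof. by apply: dirlim_op1E => ? ? ? ?; rewrite linearZ. Qed.

Definition dirlim_zero : dirlim := dirlim_in (0 : A 0).
Definition dirlim_one : dirlim := dirlim_in (1 : A 0).

Lemma dirlim_in0 n : dirlim_in (0 : A n) = dirlim_zero.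
Proof. by rewrite /dirlim_zero -(dirlim_in_map (leq0n n)) raddf0. Qed.

Lemma dirlim_in1 n : dirlim_in (1 : A n) = dirlim_one.
Proof. by rewrite /dirlim_one -(dirlim_in_map (leq0n n)) rmorph1. Qed.

Lemma dirlim_addA : associative dirlim_add.
Proof. by move=> x y z; case: (dirlim3P x y z) => n a b c; rewrite !dirlim_addE addrA. Qed.

Lemma dirlim_addC : commutative dirlim_add.
Proof. by move=> x y; case: (dirlim2P x y) => n a b; rewrite !dirlim_addE addrC. Qed.

Lemma dirlim_add0 : left_id dirlim_zero dirlim_add.
Proof.
by move=> x; case: (dirlimP x) => n a; rewrite -(dirlim_in0 n) dirlim_addE add0r.
Qed.

Lemma dirlim_addN : left_inverse dirlim_zero dirlim_opp dirlim_add.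
Proof.
move=> x; case: (dirlimP x) => n a.
by rewrite dirlim_oppE dirlim_addE addNr dirlim_in0.
Qed.

HB.instance Definition _ := GRing.isZmodule.Build dirlim
  dirlim_addA dirlim_addC dirlim_add0 dirlim_addN.

Lemma dirlim_mulA : associative dirlim_mul.
Proof. by move=> x y z; case: (dirlim3P x y z) => n a b c; rewrite !dirlim_mulE mulrA. Qed.

Lemma dirlim_mul1 : left_id dirlim_one dirlim_mul.
Proof.
by move=> x; case: (dirlimP x) => n a; rewrite -(dirlim_in1 n) dirlim_mulE mul1r.
Qed.

Lemma dirlim_mulr1 : right_id dirlim_one dirlim_mul.
Proof.
by move=> x; case: (dirlimP x) => n a; rewrite -(dirlim_in1 n) dirlim_mulE mulr1.
Qed.

Lemma dirlim_mulDl : left_distributive dirlim_mul dirlim_add.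
Proof.
move=> x y z; case: (dirlim3P x y z) => n a b c.
by rewrite !(dirlim_mulE, dirlim_addE) mulrDl.
Qed.

Lemma dirlim_mulDr : right_distributive dirlim_mul dirlim_add.
Proof.
move=> x y z; case: (dirlim3P x y z) => n a b c.
by rewrite !(dirlim_mulE, dirlim_addE) mulrDr.
Qed.

Lemma dirlim_one_neq0 : dirlim_one != dirlim_zero.
Proof.
apply/eqP => /dirlim_inP [N [h [h']]]; rewrite rmorph1 raddf0.
by move/eqP; rewrite oner_eq0.
Qed.

HB.instance Definition _ := GRing.Zmodule_isNzRing.Build dirlim
  dirlim_mulA dirlim_mul1 dirlim_mulr1 dirlim_mulDl dirlim_mulDr
  dirlim_one_neq0.

Lemma dirlim_scaleA a b x :
  dirlim_scale a (dirlim_scale b x) = dirlim_scale (a * b) x.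
Proof. by case: (dirlimP x) => n c; rewrite !dirlim_scaleE scalerA. Qed.

Lemma dirlim_scale1 : left_id 1 dirlim_scale.
Proof. by move=> x; case: (dirlimP x) => n c; rewrite dirlim_scaleE scale1r. Qed.

Lemma dirlim_scaleDr : right_distributive dirlim_scale +%R.
Proof.
move=> c x y; case: (dirlim2P x y) => n a b.
by rewrite [_ + _]dirlim_addE !dirlim_scaleE [RHS]dirlim_addE scalerDr.
Qed.

Lemma dirlim_scaleDl x : {morph dirlim_scale^~ x : a b / a + b}.
Proof.
move=> a b; case: (dirlimP x) => n c.
by rewrite !dirlim_scaleE [RHS]dirlim_addE scalerDl.
Qed.

HB.instance Definition _ := GRing.Zmodule_isLmodule.Build k dirlim
  dirlim_scaleA dirlim_scale1 dirlim_scaleDr dirlim_scaleDl.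

Lemma dirlim_scaleAl (c : k) (x y : dirlim) : c *: (x * y) = c *: x * y.
Proof.
case: (dirlim2P x y) => n a b.
have mulE (a' b' : A n) : dirlim_in a' * dirlim_in b' = dirlim_in (a' * b').
  exact: dirlim_mulE.
have scaleE (a' : A n) : c *: dirlim_in a' = dirlim_in (c *: a').
  exact: dirlim_scaleE.
by rewrite mulE !scaleE mulE scalerAl.
Qed.
HB.instance Definition _ :=
  GRing.Lmodule_isLalgebra.Build k dirlim dirlim_scaleAl.

Lemma dirlim_scaleAr (c : k) (x y : dirlim) : c *: (x * y) = x * (c *: y).
Proof.
case: (dirlim2P x y) => n a b.
have mulE (a' b' : A n) : dirlim_in a' * dirlim_in b' = dirlim_in (a' * b').
  exact: dirlim_mulE.
have scaleE (a' : A n) : c *: dirlim_in a' = dirlim_in (c *: a').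
  exact: dirlim_scaleE.
by rewrite mulE !scaleE mulE scalerAr.
Qed.
HB.instance Definition _ :=
  GRing.Lalgebra_isAlgebra.Build k dirlim dirlim_scaleAr.

Lemma dirlim_in_zmod n : zmod_morphism (@dirlim_in n).
Proof. by move=> a b; rewrite -dirlim_addE -dirlim_oppE. Qed.
HB.instance Definition _ n :=
  GRing.isZmodMorphism.Build (A n) dirlim (@dirlim_in n) (@dirlim_in_zmod n).

Lemma dirlim_in_monoid n : monoid_morphism (@dirlim_in n).
Proof. by split=> [|a b]; [exact: dirlim_in1 | rewrite -dirlim_mulE]. Qed.
HB.instance Definition _ n :=
  GRing.isMonoidMorphism.Build (A n) dirlim (@dirlim_in n) (@dirlim_in_monoid n).

Lemma dirlim_in_scalable n : scalable (@dirlim_in n).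
Proof. by move=> c a; rewrite -dirlim_scaleE. Qed.
HB.instance Definition _ n :=
  GRing.isScalable.Build k (A n) dirlim *:%R (@dirlim_in n) (@dirlim_in_scalable n).

End DirectLimit.

Import ssrint.IntDist.

Section YokonumaHecke.
Variables (k : fieldType) (d : nat) (u : k).

Section Presentation.
Variable n : nat.

(* Strands and generators are indexed from 0: inl i stands for g_(i+1)
   (0 <= i < n - 1) and inr j for t_(j+1) (0 <= j < n). *)
Definition yh_gen : choiceType := ('I_n.-1 + 'I_n)%type.

Definition yh_free_g (i : 'I_n.-1) : free_alg k yh_gen := free_gen k (inl i).
Definition yh_free_t (j : 'I_n) : free_alg k yh_gen := free_gen k (inr j).

Lemma strand_subproof (i : 'I_n.-1) : (i.+1 < n)%N.
Proof. by rewrite -ltn_predRL. Qed.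

Definition strand (i : 'I_n.-1) : 'I_n := widen_ord (leq_pred n) i.
Definition next_strand (i : 'I_n.-1) : 'I_n := Ordinal (strand_subproof i).

Definition yh_s (i : 'I_n.-1) : {perm 'I_n} :=
  tperm (strand i) (next_strand i).

(* t_(i+1)^(-s) is written t_(i+1)^(d-s), the relation t^d = 1 making t
   invertible. *)
Definition yh_free_e (i : 'I_n.-1) : free_alg k yh_gen :=
  d%:R^-1 *: \sum_(0 <= s < d)
    yh_free_t (strand i) ^+ s * yh_free_t (next_strand i) ^+ (d - s).

Local Notation g := yh_free_g.
Local Notation t := yh_free_t.
Local Notation e := yh_free_e.

Inductive yh_rel : free_alg k yh_gen -> free_alg k yh_gen -> Prop :=
  | yh_rel_far (i j : 'I_n.-1) : (1 < `|i - j|)%N ->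
      yh_rel (g i * g j) (g j * g i)
  | yh_rel_braid (i j : 'I_n.-1) : `|i - j|%N = 1%N ->
      yh_rel (g i * g j * g i) (g j * g i * g j)
  | yh_rel_tt i j : yh_rel (t i * t j) (t j * t i)
  | yh_rel_tg i j : yh_rel (t j * g i) (g i * t (yh_s i j))
  | yh_rel_tX j : yh_rel (t j ^+ d) 1
  | yh_rel_gg i :
      yh_rel (g i ^+ 2) (1 + (u - 1) *: e i + (u - 1) *: (e i * g i)).

Section Relations.
Variables (B : algType k) (gB : 'I_n.-1 -> B) (tB : 'I_n -> B).

Definition yh_eB (i : 'I_n.-1) : B :=
  d%:R^-1 *: \sum_(0 <= s < d) tB (strand i) ^+ s * tB (next_strand i) ^+ (d - s).

Record yh_relations : Prop := YHRelations {
  yh_far : forall i j : 'I_n.-1, (1 < `|i - j|)%N -> gB i * gB j = gB j * gB i;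
  yh_braid : forall i j : 'I_n.-1, `|i - j|%N = 1%N ->
    gB i * gB j * gB i = gB j * gB i * gB j;
  yh_tt : forall i j, tB i * tB j = tB j * tB i;
  yh_tg : forall i j, tB j * gB i = gB i * tB (yh_s i j);
  yh_tX : forall j, tB j ^+ d = 1;
  yh_gg : forall i,
    gB i ^+ 2 = 1 + (u - 1) *: yh_eB i + (u - 1) *: (yh_eB i * gB i)
}.

Definition yh_fun (x : yh_gen) : B :=
  match x with inl i => gB i | inr j => tB j end.

Lemma yh_rel_eval l r :
  yh_relations -> yh_rel l r -> free_eval yh_fun l = free_eval yh_fun r.
Proof.
move=> HB.
have evg i : free_eval yh_fun (g i) = gB i by rewrite free_evalE.
have evt j : free_eval yh_fun (t j) = tB j by rewrite free_evalE.
have eve i : free_eval yh_fun (e i) = yh_eB i.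
  rewrite free_evalZ free_eval_sum; congr (_ *: _); apply: eq_bigr => s _.
  by rewrite free_evalM !free_evalX !evt.
case=> {l r} [i j ij|i j ij|i j|i j|j|i].
- by rewrite !free_evalM !evg; exact: yh_far.
- by rewrite !free_evalM !evg; exact: yh_braid.
- by rewrite !free_evalM !evt; exact: yh_tt.
- by rewrite !free_evalM !evg !evt; exact: yh_tg.
- by rewrite free_evalX free_eval1 evt; exact: yh_tX.
have evZe : free_eval yh_fun ((u - 1) *: e i) = (u - 1) *: yh_eB i.
  by rewrite free_evalZ eve.
have evZeg : free_eval yh_fun ((u - 1) *: (e i * g i)) =
    (u - 1) *: (yh_eB i * gB i).
  by rewrite free_evalZ free_evalM eve evg.
rewrite free_evalX evg yh_gg // -evZe -evZeg -(free_eval1 yh_fun) -free_evalD.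
by rewrite -free_evalD.
Qed.

End Relations.

(* This one-dimensional representation shows 1 != 0, as required of rings. *)
Lemma yh_sign_relations :
  yh_relations (fun _ => -1 : k^o) (fun _ => 1 : k^o).
Proof.
split=> // [i j|j|i]; first by rewrite mulr1 mul1r.
  by rewrite expr1n.
by rewrite mulrN1 scalerN addrK sqrrN expr1n.
Qed.

End Presentation.

Definition yh_alg n := pres_alg (@yh_rel n).
HB.instance Definition _ n := GRing.Lmodule.on (yh_alg n).
HB.instance Definition _ n := GRing.PzRing.on (yh_alg n).
HB.instance Definition _ n :=
  GRing.PzSemiRing_isNonZero.Build (yh_alg n)
    (pres_alg_neq0 (fun l r => yh_rel_eval (yh_sign_relations n))).
HB.instance Definition _ n :=
  GRing.Lmodule_isLalgebra.Build k (yh_alg n) (@pres_scaleAl _ _ (@yh_rel n)).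
HB.instance Definition _ n :=
  GRing.Lalgebra_isAlgebra.Build k (yh_alg n) (@pres_scaleAr _ _ (@yh_rel n)).

Definition yh_g n (i : 'I_n.-1) : yh_alg n := pres_gen (@yh_rel n) (inl i).
Definition yh_t n (j : 'I_n) : yh_alg n := pres_gen (@yh_rel n) (inr j).

Lemma yh_rel_pi n l r :
  @yh_rel n l r -> pres_pi (@yh_rel n) l = pres_pi (@yh_rel n) r.
Proof.
move=> lr; apply/pres_piP; rewrite -[_ - _]mulr1 -[_ - _]mul1r.
exact: rel_ideal_gen.
Qed.

Lemma yh_algP n : yh_relations (@yh_g n) (@yh_t n).
Proof.
pose p : {lrmorphism free_alg k (yh_gen n) -> yh_alg n} := pres_pi (@yh_rel n).
have pg i : p (yh_free_g i) = yh_g i by rewrite /yh_g pres_genE.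
have pt j : p (yh_free_t j) = yh_t j by rewrite /yh_t pres_genE.
have pe i : p (yh_free_e i) = yh_eB (@yh_t n) i.
  rewrite linearZ raddf_sum /=; congr (_ *: _); apply: eq_bigr => s _.
  by rewrite rmorphM !rmorphXn /= !pt.
have pP l r : @yh_rel n l r -> p l = p r := @yh_rel_pi n l r.
move: p pg pt pe pP => p pg pt pe pP.
have pM x y : p (x * y) = p x * p y by rewrite rmorphM.
split=> [i j ij|i j ij|i j|i j|j|i].
- by rewrite -!pg -!pM; apply/pP/yh_rel_far.
- by rewrite -!pg -!pM; apply/pP/yh_rel_braid.
- by rewrite -!pt -!pM; apply/pP/yh_rel_tt.
- by rewrite -!pg -!pt -!pM; apply/pP/yh_rel_tg.
- by rewrite -pt -rmorphXn -(rmorph1 p); apply/pP/yh_rel_tX.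
have pZe : p ((u - 1) *: yh_free_e i) = (u - 1) *: yh_eB (@yh_t n) i.
  by rewrite linearZ /= pe.
have pZeg : p ((u - 1) *: (yh_free_e i * yh_free_g i)) =
    (u - 1) *: (yh_eB (@yh_t n) i * yh_g i).
  by rewrite linearZ /= pM pe pg.
have pD x y : p (x + y) = p x + p y by rewrite raddfD.
have p1 : p 1 = 1 by rewrite rmorph1.
rewrite -pZe -pZeg -p1 -!pD -pg -rmorphXn.
exact: (pP _ _ (yh_rel_gg i)).
Qed.

Section Inclusion.
Variables (m n : nat) (h : (m <= n)%N).

Lemma leq_predn : (m.-1 <= n.-1)%N.
Proof. by case: m n h => [|m'] [|n']. Qed.

Definition yh_incl_g0 (i : 'I_m.-1) : yh_alg n := yh_g (widen_ord leq_predn i).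
Definition yh_incl_t0 (j : 'I_m) : yh_alg n := yh_t (widen_ord h j).

Lemma yh_incl_relations : yh_relations yh_incl_g0 yh_incl_t0.
Proof.
have w1 i : widen_ord h (strand i) = strand (widen_ord leq_predn i).
  exact: val_inj.
have w2 i : widen_ord h (next_strand i) = next_strand (widen_ord leq_predn i).
  exact: val_inj.
have we i : yh_eB yh_incl_t0 i = yh_eB (@yh_t n) (widen_ord leq_predn i).
  by rewrite /yh_eB /yh_incl_t0 w1 w2.
have [Hfar Hbraid Htt Htg HtX Hgg] := yh_algP n.
split=> [i j ij|i j ij|i j|i j|j|i]; rewrite /yh_incl_g0 /yh_incl_t0.
- exact: Hfar.
- exact: Hbraid.
- exact: Htt.
- rewrite Htg /yh_s inj_tperm ?w1 ?w2 // => a b /(congr1 val) /= ab.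
  exact: val_inj.
- exact: HtX.
by rewrite we; exact: Hgg.
Qed.

Lemma yh_incl_rel l r : @yh_rel m l r ->
  free_eval (yh_fun yh_incl_g0 yh_incl_t0) l =
  free_eval (yh_fun yh_incl_g0 yh_incl_t0) r.
Proof. exact: yh_rel_eval yh_incl_relations. Qed.

Definition yh_incl : yh_alg m -> yh_alg n :=
  pres_eval (yh_fun yh_incl_g0 yh_incl_t0).

HB.instance Definition _ := GRing.isZmodMorphism.Build _ _ yh_incl
  (pres_eval_zmod yh_incl_rel).
HB.instance Definition _ := GRing.isMonoidMorphism.Build _ _ yh_incl
  (pres_eval_monoid yh_incl_rel).
HB.instance Definition _ := GRing.isScalable.Build k _ _ *:%R yh_incl
  (pres_eval_scalable yh_incl_rel).

Lemma yh_incl_g i : yh_incl (yh_g i) = yh_g (widen_ord leq_predn i).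
Proof. exact: (pres_eval_gen yh_incl_rel). Qed.

Lemma yh_incl_t j : yh_incl (yh_t j) = yh_t (widen_ord h j).
Proof. exact: (pres_eval_gen yh_incl_rel). Qed.

End Inclusion.

Lemma yh_ind n (P : yh_alg n -> Prop) :
    (forall c x y, P x -> P y -> P (c *: x + y)) -> P 1 ->
    (forall i x, P x -> P (yh_g i * x)) -> (forall j x, P x -> P (yh_t j * x)) ->
  forall x, P x.
Proof.
move=> PD P1 Pg Pt; apply: pres_ind => // -[i|j] x Px; first exact: Pg.
exact: Pt.
Qed.

Lemma yh_incl_comp l m n (h : (l <= m)%N) (h' : (m <= n)%N) (h'' : (l <= n)%N)
  (a : yh_alg l) : yh_incl h' (yh_incl h a) = yh_incl h'' a.
Proof.
elim/yh_ind: a => [c x y Hx Hy||i x Hx|j x Hx]; last 2 first.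
- rewrite !rmorphM /= Hx !yh_incl_g; congr (yh_g _ * _); exact: val_inj.
- rewrite !rmorphM /= Hx !yh_incl_t; congr (yh_t _ * _); exact: val_inj.
- by rewrite !linearP /= Hx Hy.
by rewrite !rmorph1.
Qed.

Definition yh_union :=
  dirlim (f := fun m n h => yh_incl h) yh_incl_comp.

HB.instance Definition _ := GRing.Algebra.on yh_union.

Definition yh_in n : {lrmorphism yh_alg n -> yh_union} :=
  @dirlim_in _ _ _ yh_incl_comp n.

Lemma yh_in_incl m n (h : (m <= n)%N) (a : yh_alg m) :
  yh_in n (yh_incl h a) = yh_in m a.
Proof. exact: dirlim_in_map. Qed.

End YokonumaHecke.

(* k[z, x_1, ..., x_(d-1)] for d > 0: variable 0 is z, variable m is x_m. *)
Notation trace_ring k d := {mpoly k[d.-1.+1]}.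

Section Trace.
Variables (k : fieldType) (d : nat) (u : k).
Local Notation Y n := (yh_alg d u n).
Local Notation Yoo := (yh_union d u).

(* yh_G n is g_(n+1), which lives in Y_(n+2), and yh_T n is t_(n+1), which
   lives in Y_(n+1). *)
Definition yh_G (n : nat) : Yoo := yh_in d u n.+2 (yh_g d u (n := n.+2) ord_max).
Definition yh_T (n : nat) : Yoo := yh_in d u n.+1 (yh_t d u (ord_max : 'I_n.+1)).

Definition trace_z : trace_ring k d := 'X_ord0.
Definition trace_x (m : nat) : trace_ring k d := 'X_(inord m).

Definition juyumaya_trace (tr : {linear Yoo -> trace_ring k d}) : Prop :=
  [/\ forall n (a b : Y n), tr (yh_in d u n (a * b)) = tr (yh_in d u n (b * a)),
      tr 1 = 1,
      forall n (a : Y n.+1),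
        tr (yh_in d u n.+1 a * yh_G n) = trace_z * tr (yh_in d u n.+1 a)
    & forall n (a : Y n) m, (0 < m < d)%N ->
        tr (yh_in d u n a * yh_T n ^+ m) = trace_x m * tr (yh_in d u n a)].

(* The word g_n g_(n-1) ... g_(i+1), in the indexing from 1; it is empty if
   i = n. *)
Definition yh_Gs (n i : nat) : Yoo := \prod_(j <- rev (index_iota i n)) yh_G j.

(* c s is the parameter x_s (with c 0 = 1); exponents in Z/dZ are represented
   by 0 <= s < d. *)
Definition yh_phi_rules (c : nat -> k) (phi : {linear Yoo -> Yoo}) : Prop :=
  [/\ phi 1 = 1,
      forall n (w : Y n.+1) (i s : nat), (i <= n)%N -> (s < d)%N ->
        phi (yh_in d u n.+1 w * yh_Gs n.+1 i * yh_T i ^+ s) =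
        yh_G n * phi (yh_in d u n.+1 w * yh_Gs n i * yh_T i ^+ s)
    & forall n (w : Y n) (s : nat), (s < d)%N ->
        phi (yh_in d u n w * yh_T n ^+ s) = c s *: phi (yh_in d u n w)].

Definition specialize_x (c : nat -> k) (p : trace_ring k d) : {poly k} :=
  mpoly.mmap polyC
    (fun m : 'I_d.-1.+1 => if m == ord0 then 'X else (c m)%:P) p.

(* The inclusion of k[z] in k[z, x_1, ..., x_(d-1)]. *)
Definition poly_z_in (p : {poly k}) : trace_ring k d :=
  (map_poly (@mpolyC d.-1.+1 k) p).[trace_z].

End Trace.

(* Main.v *)
Require Import Defs.
From HB Require Import structures.
From mathcomp Require Import all_boot all_order perm all_algebra.
From mathcomp Require Import boolp reals complex mpoly monalg.

Set Implicit Arguments.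
Unset Strict Implicit.
Unset Printing Implicit Defensive.

Import GRing.Theory.
Local Open Scope ring_scope.

(** Proof. The relations let one push any g_j or t_j from the right of a word
    w g_m ... g_i t_i^s (w in Y_m) into w or into another word of this shape, so
    these words span Y_(m+1). Induction on n then shows at once that phi maps
    Y_n to itself and that tr o phi = theta o tr on Y_n: on words ending in
    t_(n+1)^s both sides pick up the factor x_s, and on w g_n v, with v in Y_n,
    phi yields g_n phi(w v), so that both sides are z theta(tr (w v)) because
    tr (g_n phi(w v)) = tr (phi(w v) g_n) and tr (w g_n v) = tr (v w g_n). *)

(** * The generators and their relations inside the union of the tower *)

Section Union.
Variables (k : fieldType) (d : nat) (u : k).
Local Notation Y n := (yh_alg d u n).
Local Notation Yoo := (yh_union d u).
Local Notation G := (yh_G d u).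
Local Notation T := (yh_T d u).
Local Notation Gs := (yh_Gs d u).

Lemma yh_GE n (i : 'I_n.-1) : G i = yh_in d u n (yh_g d u i).
Proof.
have h : (i.+2 <= n)%N by rewrite -ltn_predRL.
rewrite /yh_G -(yh_in_incl h) yh_incl_g; congr (yh_in d u n (yh_g d u _)).
exact: val_inj.
Qed.

Lemma yh_TE n (j : 'I_n) : T j = yh_in d u n (yh_t d u j).
Proof.
have h : (j.+1 <= n)%N by [].
rewrite /yh_T -(yh_in_incl h) yh_incl_t; congr (yh_in d u n (yh_t d u _)).
exact: val_inj.
Qed.

Lemma yh_inM n (a b : Y n) :
  yh_in d u n (a * b) = yh_in d u n a * yh_in d u n b.
Proof. exact: rmorphM. Qed.

Lemma yh_inD n (a b : Y n) :
  yh_in d u n (a + b) = yh_in d u n a + yh_in d u n b.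
Proof. exact: raddfD. Qed.

Lemma yh_inZ n c (a : Y n) : yh_in d u n (c *: a) = c *: yh_in d u n a.
Proof. exact: linearZ. Qed.

Lemma yh_inX n (a : Y n) s : yh_in d u n (a ^+ s) = yh_in d u n a ^+ s.
Proof. exact: rmorphXn. Qed.

Lemma yh_in1 n : yh_in d u n 1 = 1.
Proof. exact: rmorph1. Qed.

(** The relations of $Y_n$ persist under the morphism [yh_in]. Each relation below follows by taking
    [n] just large enough for the generators involved. *)
Lemma yh_union_relations n :
  yh_relations d u (fun i : 'I_n.-1 => G i) (fun j : 'I_n => T j).
Proof.
have [Hfar Hbraid Htt Htg HtX Hgg] := yh_algP d u n.
have eE i : yh_eB d (fun j : 'I_n => T j) i
    = yh_in d u n (yh_eB d (yh_t d u (n := n)) i).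
  rewrite yh_inZ raddf_sum /=; congr (_ *: _); apply: eq_bigr => s _.
  by rewrite yh_inM !yh_inX -!yh_TE.
split=> [i j ij|i j ij|i j|i j|j|i]; rewrite ?yh_GE ?yh_TE.
- by rewrite -!yh_inM Hfar.
- by rewrite -!yh_inM Hbraid.
- by rewrite -!yh_inM Htt.
- by rewrite -!yh_inM Htg.
- by rewrite -yh_inX HtX yh_in1.
by rewrite -yh_inX Hgg eE !yh_inD !(yh_inZ (u - 1)) yh_inM yh_in1.
Qed.

(* yh_E i i.+1 is e_(i+1); two free indices are needed because
   e_(i+1) g_(i+1) = g_(i+1) (yh_E i.+1 i) holds on the nose. *)
Definition yh_E (i j : nat) : Yoo :=
  d%:R^-1 *: \sum_(0 <= s < d) T i ^+ s * T j ^+ (d - s).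

Lemma yh_TT i j : T i * T j = T j * T i.
Proof.
wlog ij : i j / (i <= j)%N.
  by move=> H; case: (leqP i j) => [|/ltnW] /H.
exact: (yh_tt (yh_union_relations j.+1) (Ordinal (ij : i < j.+1)%N) ord_max).
Qed.

Lemma yh_TX j : T j ^+ d = 1.
Proof. exact: (yh_tX (yh_union_relations j.+1) ord_max). Qed.

Lemma yh_GG_far i j : (i.+1 < j)%N -> G i * G j = G j * G i.
Proof.
move=> ij; have i' : (i < j.+2.-1)%N by rewrite /= ltnS (ltnW (ltnW ij)).
apply: (yh_far (yh_union_relations j.+2) (i := Ordinal i') (j := ord_max)) => /=.
by rewrite ssrint.IntDist.distnEr ?ltn_subRL ?addn1 // (ltnW (ltnW ij)).
Qed.

Lemma yh_GG_braid i : G i * G i.+1 * G i = G i.+1 * G i * G i.+1.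
Proof.
have i' : (i < i.+3.-1)%N by [].
apply: (yh_braid (yh_union_relations i.+3) (i := Ordinal i') (j := ord_max)).
exact: ssrint.IntDist.distnS.
Qed.

Lemma yh_TG_far i j : j != i -> j != i.+1 -> T j * G i = G i * T j.
Proof.
move=> ji jSi; pose n := (maxn i.+2 j.+1).
have i' : (i < n.-1)%N by rewrite ltn_predRL /n leq_max leqnn.
have j' : (j < n)%N by rewrite /n leq_max leqnn orbT.
have := yh_tg (yh_union_relations n) (Ordinal i') (Ordinal j').
by rewrite /yh_s tpermD // eq_sym.
Qed.

Lemma yh_TG i : T i * G i = G i * T i.+1.
Proof.
have i' : (i < i.+2.-1)%N by [].
have := yh_tg (yh_union_relations i.+2) (Ordinal i') (strand (Ordinal i')).
by rewrite /yh_s tpermL.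
Qed.

Lemma yh_TSG i : T i.+1 * G i = G i * T i.
Proof.
have i' : (i < i.+2.-1)%N by [].
have := yh_tg (yh_union_relations i.+2) (Ordinal i') (next_strand (Ordinal i')).
by rewrite /yh_s tpermR.
Qed.

Lemma yh_GG i :
  G i * G i = 1 + (u - 1) *: yh_E i i.+1 + (u - 1) *: (yh_E i i.+1 * G i).
Proof.
have i' : (i < i.+2.-1)%N by [].
exact: (yh_gg (yh_union_relations i.+2) (Ordinal i')).
Qed.

Lemma yh_TXG i j l s : T i * G l = G l * T j -> T i ^+ s * G l = G l * T j ^+ s.
Proof.
move=> H; elim: s => [|s IHs]; first by rewrite !expr0 mul1r mulr1.
by rewrite exprSr -mulrA H mulrA IHs -mulrA -exprSr.
Qed.

Lemma yh_EG i : yh_E i i.+1 * G i = G i * yh_E i.+1 i.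
Proof.
rewrite /yh_E -scalerAl -scalerAr mulr_suml mulr_sumr; congr (_ *: _).
apply: eq_bigr => s _; rewrite -mulrA (yh_TXG _ (yh_TSG i)).
by rewrite mulrA (yh_TXG _ (yh_TG i)) mulrA.
Qed.

(** * Moving generators through the descending words [Gs m i] *)

Lemma yh_Gs_id m : Gs m m = 1.
Proof. by rewrite /yh_Gs /index_iota subnn big_nil. Qed.

Lemma yh_Gs_recl m i : (i <= m)%N -> Gs m.+1 i = G m * Gs m i.
Proof.
move=> im; rewrite /yh_Gs /index_iota subSn // -addn1 iotaD subnKC //= cats1.
by rewrite rev_rcons big_cons.
Qed.

Lemma yh_Gs_recr m i : (i < m)%N -> Gs m i = Gs m i.+1 * G i.
Proof.
move=> im; rewrite /yh_Gs /index_iota -(subnSK im) /= rev_cons -cats1.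
by rewrite big_cat big_seq1.
Qed.

Lemma yh_Gs_cat m i j : (i <= j)%N -> (j <= m)%N -> Gs m i = Gs m j * Gs j i.
Proof.
move=> ij; elim: m => [|m IHm].
  by case: j ij => //; case: i => // _ _; rewrite yh_Gs_id mulr1.
rewrite leq_eqVlt => /predU1P[->|jm]; first by rewrite yh_Gs_id mul1r.
by rewrite !yh_Gs_recl ?(leq_trans ij) // IHm // mulrA.
Qed.

Lemma yh_Gs_comm m i (x : Yoo) :
    (forall j, (i <= j < m)%N -> G j * x = x * G j) ->
  Gs m i * x = x * Gs m i.
Proof.
move=> H; rewrite /yh_Gs big_seq.
elim/big_rec: _ => [|j y]; first by rewrite mul1r mulr1.
by rewrite mem_rev mem_index_iota => /H Hj Hy; rewrite -mulrA Hy !mulrA Hj.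
Qed.

(** If [j < i], [T j] commutes with every letter; if [j > i], it meets [G j.-1], drops to [T j.-1]
    and commutes with the rest. [T i] would come out as [T m], beyond the bound. *)
Lemma yh_Gs_T m i j : (i <= m)%N -> (j <= m)%N -> j != i ->
  exists2 j', (j' < m)%N & Gs m i * T j = T j' * Gs m i.
Proof.
move=> im jm; rewrite neq_ltn => /orP[ji|].
  exists j; first exact: leq_trans im.
  apply: yh_Gs_comm => l /andP[il _]; rewrite yh_TG_far //.
    by rewrite ltn_eqF // (leq_trans ji).
  by rewrite ltn_eqF // (leq_trans ji) // leqW.
case: j jm => // j jm; rewrite ltnS => ij; exists j => //.
rewrite (yh_Gs_cat ij (ltnW jm)) (yh_Gs_recr jm) -!mulrA.
rewrite (_ : Gs j i * T j.+1 = T j.+1 * Gs j i); last first.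
  apply: yh_Gs_comm => l /andP[_ lj]; rewrite yh_TG_far //.
    by rewrite gtn_eqF // leqW.
  by rewrite gtn_eqF.
rewrite !mulrA -(mulrA _ (G j)) -yh_TG mulrA.
rewrite (_ : Gs m j.+1 * T j = T j * Gs m j.+1) // ?mulrA //.
apply: yh_Gs_comm => l /andP[jl _].
by rewrite yh_TG_far // ltn_eqF // leqW.
Qed.

(** [G j] commutes leftwards up to the adjacent letters [G j], [G j.-1] of the word; the braid
    relation turns it into [G j.-1], which commutes with all letters further left. *)
Lemma yh_Gs_G m i j : (i < j < m)%N -> Gs m i * G j = G j.-1 * Gs m i.
Proof.
case/andP; case: j => // j; rewrite ltnS => ij jm.
rewrite (yh_Gs_cat ij (ltnW (ltnW jm))) (yh_Gs_recr (ltnW jm)) (yh_Gs_recr jm).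
rewrite -!mulrA (_ : Gs j i * G j.+1 = G j.+1 * Gs j i); last first.
  by apply: yh_Gs_comm => l /andP[_ lj]; rewrite yh_GG_far.
rewrite (mulrA (G j)) (mulrA (G j.+1)) (mulrA (G j.+1)) -yh_GG_braid !mulrA.
rewrite (_ : Gs m j.+2 * G j = G j * Gs m j.+2) //.
by apply: yh_Gs_comm => l /andP[jl _]; rewrite (yh_GG_far jl).
Qed.

(** * Membership in $Y_m$, and spanning of $Y_{m+1}$ by the inductive words *)

Definition yh_sub m (x : Yoo) : Prop := exists a : Y m, x = yh_in d u m a.

Lemma yh_subP m (a : Y m) : yh_sub m (yh_in d u m a).
Proof. by exists a. Qed.

Lemma yh_subW m n x : (m <= n)%N -> yh_sub m x -> yh_sub n x.
Proof. by move=> h [a ->]; exists (yh_incl h a); rewrite yh_in_incl. Qed.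

Lemma yh_sub1 m : yh_sub m 1.
Proof. by exists 1; rewrite yh_in1. Qed.

Lemma yh_subM m x y : yh_sub m x -> yh_sub m y -> yh_sub m (x * y).
Proof. by move=> [a ->] [b ->]; exists (a * b); rewrite yh_inM. Qed.

Lemma yh_sub_lin m c x y : yh_sub m x -> yh_sub m y -> yh_sub m (c *: x + y).
Proof. by move=> [a ->] [b ->]; exists (c *: a + b); rewrite yh_inD yh_inZ. Qed.

Lemma yh_subZ m c x : yh_sub m x -> yh_sub m (c *: x).
Proof. by move=> [a ->]; exists (c *: a); rewrite yh_inZ. Qed.

Lemma yh_subG m i : (i.+1 < m)%N -> yh_sub m (G i).
Proof.
by rewrite -ltn_predRL => im; rewrite (yh_GE (Ordinal im)); apply: yh_subP.
Qed.

Lemma yh_subT m j : (j < m)%N -> yh_sub m (T j).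
Proof. by move=> jm; rewrite (yh_TE (Ordinal jm)); apply: yh_subP. Qed.

Lemma yh_subTX m j s : (j < m)%N -> yh_sub m (T j ^+ s).
Proof.
move=> jm; elim: s => [|s IHs]; first by rewrite expr0; apply: yh_sub1.
by rewrite exprS; apply: yh_subM => //; apply: yh_subT.
Qed.

Lemma yh_subGs m i : yh_sub m.+1 (Gs m i).
Proof.
rewrite /yh_Gs big_seq; elim/big_rec: _ => [|j x]; first exact: yh_sub1.
rewrite mem_rev mem_index_iota => /andP[_ jm] Hx.
by apply: yh_subM => //; apply: yh_subG.
Qed.

(** The case [i = m] gives the words $w\,t_{m+1}^s$, as [Gs m m = 1]. Exponents are not bounded by
    [d], so that multiplication by [T i] keeps the shape of a word. *)
Inductive yh_span m : Yoo -> Prop :=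
  | yh_span_lin c x y : yh_span m x -> yh_span m y -> yh_span m (c *: x + y)
  | yh_span_word w i s : yh_sub m w -> (i <= m)%N ->
      yh_span m (w * Gs m i * T i ^+ s).

Lemma yh_span1 m : yh_span m 1.
Proof.
have := @yh_span_word m 1 m 0 (yh_sub1 m) (leqnn m).
by rewrite yh_Gs_id expr0 !mulr1.
Qed.

Lemma yh_span0 m : yh_span m 0.
Proof.
by have := yh_span_lin (-1) (yh_span1 m) (yh_span1 m); rewrite scaleN1r addNr.
Qed.

Lemma yh_spanD m x y : yh_span m x -> yh_span m y -> yh_span m (x + y).
Proof. by move=> Hx Hy; rewrite -(scale1r x); apply: yh_span_lin. Qed.

Lemma yh_spanZ m c x : yh_span m x -> yh_span m (c *: x).
Proof.
by move=> Hx; rewrite -(addr0 (_ *: _)); apply: yh_span_lin => //; apply: yh_span0.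
Qed.

Lemma yh_spanT m x j : (j <= m)%N -> yh_span m x -> yh_span m (x * T j).
Proof.
move=> jm; elim=> [c y z _ Hy _ Hz|w i s Hw im].
  by rewrite mulrDl -scalerAl; apply: yh_span_lin.
have [->|ji] := eqVneq j i.
  by rewrite -mulrA -exprSr; apply: yh_span_word.
have [j' jm' E] := yh_Gs_T im jm ji.
have -> : w * Gs m i * T i ^+ s * T j = w * T j' * Gs m i * T i ^+ s.
  rewrite -!mulrA -(commrX s (yh_TT j i)).
  by congr (_ * _); rewrite !mulrA E.
by apply: yh_span_word => //; apply: yh_subM => //; apply: yh_subT.
Qed.

Lemma yh_spanTX m x j s : (j <= m)%N -> yh_span m x -> yh_span m (x * T j ^+ s).
Proof.
move=> jm Hx; elim: s => [|s IHs]; first by rewrite mulr1.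
by rewrite exprSr mulrA; apply: yh_spanT.
Qed.

Lemma yh_spanE m x i j : (i <= m)%N -> (j <= m)%N ->
  yh_span m x -> yh_span m (x * yh_E i j).
Proof.
move=> im jm Hx; rewrite -scalerAr mulr_sumr; apply: yh_spanZ.
elim/big_rec: _ => [|s y _ Hy]; first exact: yh_span0.
by apply: yh_spanD => //; rewrite mulrA; do 2!apply: yh_spanTX => //.
Qed.

(** Once past the power of [T i], [G j] lengthens the word if [j.+1 = i], is absorbed into [w] if
    [j.+1 < i] or [i < j], and produces a square if [j = i]. *)
Lemma yh_spanG m x j : (j < m)%N -> yh_span m x -> yh_span m (x * G j).
Proof.
move=> jm; elim=> [c y z _ Hy _ Hz|w i s Hw im].
  by rewrite mulrDl -scalerAl; apply: yh_span_lin.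
have word0 l : (l <= m)%N -> yh_span m (w * Gs m l).
  by move=> lm; have := yh_span_word 0 Hw lm; rewrite mulr1.
have [ji|ij|jE] := ltngtP j i.
- have [iE|Sji] := eqVneq i j.+1.
    rewrite iE -mulrA (yh_TXG _ (yh_TSG j)) mulrA -(mulrA w).
    by rewrite -yh_Gs_recr //; apply: yh_span_word => //; apply: ltnW.
  have Sji' : (j.+1 < i)%N by rewrite ltn_neqAle eq_sym Sji.
  rewrite -mulrA (yh_TXG _ (yh_TG_far _ Sji)) ?gtn_eqF //.
  rewrite mulrA -(mulrA w) (_ : Gs m i * G j = G j * Gs m i); last first.
    by apply: yh_Gs_comm => l /andP[il _]; rewrite (yh_GG_far (leq_trans Sji' il)).
  rewrite mulrA; apply: yh_span_word => //; apply: yh_subM => //.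
  by apply: yh_subG; apply: leq_trans im.
(* The letter leaves the word as [G j.-1], which lies in $Y_m$ because [j < m]. *)
- rewrite -mulrA (yh_TXG _ (yh_TG_far _ _)) ?ltn_eqF // 1?leqW //.
  rewrite mulrA -(mulrA w) yh_Gs_G ?ij // mulrA; apply: yh_span_word => //.
  apply: yh_subM => //; apply: yh_subG; rewrite prednK //.
  exact: leq_trans ij.
subst j; rewrite -mulrA (yh_TXG _ (yh_TG i)) mulrA; apply: yh_spanTX => //.
(* In the last term of the quadratic relation, $eg$ becomes $ge$: then $g$ completes [Gs m i] and
   $e$ acts from the right. *)
rewrite yh_Gs_recr // mulrA -mulrA yh_GG yh_EG !mulrDr mulr1 -!(scalerAr (u - 1)).
apply: yh_spanD; first apply: yh_spanD.
- exact: word0.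
- by apply/yh_spanZ/yh_spanE => //; apply: word0.
apply: yh_spanZ; rewrite mulrA -(mulrA w) -yh_Gs_recr //.
by apply: yh_spanE => //; apply: word0.
Qed.

Lemma yh_span_total m (a : Y m.+1) : yh_span m (yh_in d u m.+1 a).
Proof.
(* [yh_ind] peels generators off the left of [a], so the induction needs an arbitrary left factor
   [x] in the span. *)
suff H x : yh_span m x -> yh_span m (x * yh_in d u m.+1 a).
  by rewrite -(mul1r (yh_in _ _ _ a)); apply/H/yh_span1.
elim/yh_ind: a x => [c a b Ha Hb||i a Ha|j a Ha] x Hx.
- rewrite yh_inD yh_inZ mulrDr -scalerAr.
  by apply: yh_span_lin; [apply: Ha|apply: Hb].
- by rewrite yh_in1 mulr1.
- by rewrite yh_inM -yh_GE mulrA; apply/Ha/yh_spanG.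
have jm : (j <= m)%N by rewrite -ltnS.
by rewrite yh_inM -yh_TE mulrA; apply: Ha; apply: yh_spanT.
Qed.

(** $Y_0$ has no generators, both index types being empty. This serves the base of the final
    induction. *)
Lemma yh_alg0_scalar (a : Y 0) : exists c, a = c *: 1.
Proof.
elim/yh_ind: a => [c x y [a ->] [b ->]||[]//|[]//].
  by exists (c * a + b); rewrite scalerDl scalerA.
by exists 1; rewrite scale1r.
Qed.

End Union.

(** * The specialization $\theta$, followed by the inclusion of $k[z]$ *)

Section Specialization.
Variables (k : fieldType) (d : nat) (c : nat -> k).
Local Notation theta p := (poly_z_in d (specialize_x c p)).

Lemma poly_z_inM (p q : {poly k}) : poly_z_in d (p * q) = poly_z_in d p * poly_z_in d q.
Proof. by rewrite /poly_z_in rmorphM hornerM. Qed.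

Lemma poly_z_inC (a : k) : poly_z_in d a%:P = a%:MP_[d.-1.+1].
Proof. by rewrite /poly_z_in map_polyC hornerC. Qed.

Lemma thetaD (p q : trace_ring k d) : theta (p + q) = theta p + theta q.
Proof. by rewrite /poly_z_in /specialize_x mpoly.mmapD raddfD hornerD. Qed.

Lemma thetaM (p q : trace_ring k d) : theta (p * q) = theta p * theta q.
Proof. by rewrite -poly_z_inM /specialize_x rmorphM. Qed.

Lemma thetaC (a : k) : theta (a%:MP_[d.-1.+1]) = a%:MP_[d.-1.+1].
Proof. by rewrite /specialize_x mpoly.mmapC poly_z_inC. Qed.

Lemma thetaZ a (p : trace_ring k d) : theta (a *: p) = a *: theta p.
Proof. by rewrite -!mul_mpolyC thetaM thetaC. Qed.

Lemma theta1 : theta (1 : trace_ring k d) = 1.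
Proof. by rewrite -mpolyC1 thetaC. Qed.

Lemma theta_z : theta (trace_z k d) = trace_z k d.
Proof.
rewrite /specialize_x mpoly.mmapX mpoly.mmap1U eqxx /poly_z_in.
by rewrite map_polyX hornerX.
Qed.

Lemma theta_x m : (0 < m < d)%N -> theta (trace_x k d m) = (c m)%:MP_[d.-1.+1].
Proof.
case/andP=> m0 md; have d0 : (0 < d)%N by exact: leq_trans md.
(* [m < d] keeps [inord m] from defaulting to index 0, that of $z$; [0 < m] then separates $x_m$
   from $z$. *)
have mE : nat_of_ord (inord m : 'I_d.-1.+1) = m by rewrite inordK // prednK.
rewrite /specialize_x mpoly.mmapX mpoly.mmap1U mE -val_eqE /= mE.
by rewrite gtn_eqF // poly_z_inC.
Qed.

End Specialization.

(** * The identity $\mathrm{tr}\circ\varphi=\theta\circ\mathrm{tr}$, by induction along the tower *)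

Section Intertwining.
Variables (k : fieldType) (d : nat) (u : k).
Local Notation Y n := (yh_alg d u n).
Local Notation Yoo := (yh_union d u).
Local Notation G := (yh_G d u).
Local Notation T := (yh_T d u).
Local Notation Gs := (yh_Gs d u).
Hypothesis d_gt0 : (0 < d)%N.
Variables (c : nat -> k) (c0 : c 0%N = 1).
Variables (phi : {linear Yoo -> Yoo}) (phiP : yh_phi_rules c phi).
Variables (tr : {linear Yoo -> trace_ring k d}) (trP : juyumaya_trace tr).
Local Notation theta p := (poly_z_in d (specialize_x c p)).

(** Brings the free exponents of [yh_span] into the range below [d] where the rules for [phi] and
    [tr] apply. *)
Lemma yh_TX_mod j s : T j ^+ s = T j ^+ (s %% d).
Proof. by rewrite {1}(divn_eq s d) exprD mulnC exprM yh_TX expr1n mul1r. Qed.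

Lemma tr_sub m x y : yh_sub m x -> yh_sub m y -> tr (x * y) = tr (y * x).
Proof.
by case: trP => trC _ _ _ [a ->] [b ->]; rewrite -!yh_inM trC.
Qed.

Lemma tr_G n x : yh_sub n.+1 x -> tr (x * G n) = trace_z k d * tr x.
Proof. by case: trP => _ _ trz _ [a ->]; apply: trz. Qed.

Lemma tr_T_theta n x s : yh_sub n x -> (s < d)%N ->
  theta (tr (x * T n ^+ s)) = c s *: theta (tr x).
Proof.
case: trP => _ _ _ trx [a ->] sd.
(* The trace rule starts at exponent 1; exponent 0 is covered by the convention [c 0 = 1]. *)
have [->|s0] := posnP s; first by rewrite expr0 mulr1 c0 scale1r.
by rewrite trx ?s0 // thetaM theta_x ?s0 // mul_mpolyC.
Qed.

(** The two claims are proved together: [tr_G] applies to [phi (w * v)] only once this element is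
    known to lie in the smaller algebra. *)
Lemma phi_tr_sub n x : yh_sub n x ->
  yh_sub n (phi x) /\ tr (phi x) = theta (tr x).
Proof.
have [phi1 phiG phiT] := phiP.
elim: n x => [|n IHn] _ [a ->].
  have [r ->] := yh_alg0_scalar a.
  rewrite yh_inZ yh_in1 linearZ /= phi1; split; first exact/yh_subZ/yh_sub1.
  rewrite linearZ /= thetaZ; congr (_ *: _).
  by case: trP => _ -> _ _; rewrite theta1.
elim: (yh_span_total a) => {a} [r x y _ [Hx Ex] _ [Hy Ey]|w i s Hw].
  rewrite linearP; split; first exact: yh_sub_lin.
  by rewrite /= !linearP /= thetaD thetaZ Ex Ey.
rewrite yh_TX_mod; move: (s %% d)%N (ltn_pmod s d_gt0) => {}s sd.
rewrite leq_eqVlt => /predU1P[->|].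
  rewrite yh_Gs_id mulr1 (tr_T_theta Hw sd).
  have [Hphi <-] := IHn w Hw; case: Hw Hphi => b -> Hphi.
  rewrite phiT // linearZ /=; split=> //.
  by apply: yh_subZ; apply: yh_subW Hphi.
(* [i < n] forces [n] to be a successor, the form in which the rule for [phi] is stated. *)
case: n IHn Hw => // n IHn Hw; rewrite ltnS => ni.
pose v := Gs n i * T i ^+ s.
have Hv : yh_sub n.+1 v by apply: yh_subM; [apply: yh_subGs|apply: yh_subTX].
have Hwv := yh_subM Hw Hv; have [Hphi Ephi] := IHn _ Hwv.
have up (y : Yoo) : yh_sub n.+1 y -> yh_sub n.+2 y by apply: yh_subW.
have HG : yh_sub n.+2 (G n) by apply: yh_subG.
have -> : phi (w * Gs n.+1 i * T i ^+ s) = G n * phi (w * v).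
  by case: Hw => b ->; rewrite phiG // -mulrA.
split; first by apply: yh_subM => //; apply: up.
(* As $\theta(z)=z$, the factor $z$ moves inside $\theta$ and is turned back into a letter [G n],
   which cyclicity places between [w] and [v]. *)
rewrite (tr_sub HG (up _ Hphi)) tr_G // Ephi -{1}(theta_z d c) -thetaM.
rewrite (tr_sub Hw Hv) -(tr_G (yh_subM Hv Hw)).
rewrite -mulrA (tr_sub (up _ Hv)); last by apply: yh_subM => //; apply: up.
by rewrite yh_Gs_recl // /v !mulrA.
Qed.

End Intertwining.

Theorem proposition2 (R : realType) (d : nat) (hd : (0 < d)%N)
    (u : R[i]) (hu : u != 0)
    (x : nat -> R[i]) (hx0 : x 0%N = 1)
    (hx : forall m : nat, (0 < m < d)%N -> x m != 0)
    (phi : {linear yh_union d u -> yh_union d u}) (hphi : yh_phi_rules x phi)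
    (tr : {linear yh_union d u -> trace_ring R[i] d})
    (htr : juyumaya_trace tr) :
  forall a : yh_union d u, tr (phi a) = poly_z_in d (specialize_x x (tr a)).
Proof.
(* Every element of the direct limit comes from a single $Y_n$, that of its representative. *)
move=> a; rewrite (dirlim_repr a).
by case: (phi_tr_sub hd hx0 hphi htr (yh_subP (tagged (repr a)))).
Qed.
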